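(* Let $r > 2$ be an integer and let $T_r$ be the triangular grid graph of dimension $r$. Then $OD(T_r) = r+1$.
   Context: The triangular grid graph $T_r$ of dimension $r$ has as vertex set all ordered triples $(i,j,k)$ of nonnegative integers with $i+j+k=r$; two vertices $(i,j,k)$ and $(i',j',k')$ are adjacent if and only if $|i-i'|+|j-j'|+|k-k'| = 2$. An orientation of an undirected graph assigns a direction to each edge; it is strongly connected if every vertex can reach every other vertex by a directed path. The diameter of a directed graph is the maximum, over all ordered pairs of vertices, of the shortest directed path distance, measured in number of edges. The oriented diameter $OD(G)$ of an undirected graph $G$ is the minimum diameter over all strongly connected orientations of $G$. *)

(* Defs.v *)
From mathcomp Require Import all_boot all_algebra.
Import IntDist.

Set Implicit Arguments.
Unset Strict Implicit.
Unset Printing Implicit Defensive.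

Section OrientedDiameter.
Variable V : finType.
Implicit Types (e o : rel V) (x y : V).

(* A simple graph is its (symmetric, irreflexive) adjacency relation e; an
   orientation keeps exactly one of the arcs (x, y), (y, x) for each edge. *)
Definition orientation e o : Prop :=
  (forall x y, o x y -> e x y) /\ (forall x y, e x y -> o x y = ~~ o y x).

Definition strongly_connected o : Prop := forall x y, connect o x y.

Definition has_dipath o n x y : bool :=
  [exists p : n.-tuple V, path o x p && (last x p == y)].

(* The least n such that y is reached from x along n arcs. A shortest path
   repeats no vertex, so n < #|V|; the value is #|V| when y is unreachable. *)
Definition didist o x y : nat :=
  find (fun n => has_dipath o n x y) (iota 0 #|V|).

Definition diameter o : nat := \max_(x : V) \max_(y : V) didist o x y.

(* d is the minimum diameter over the strongly connected orientations of e;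
   in particular such an orientation exists. *)
Definition is_oriented_diameter e (d : nat) : Prop :=
  (exists o, [/\ orientation e o, strongly_connected o & diameter o = d]) /\
  (forall o, orientation e o -> strongly_connected o -> d <= diameter o).

End OrientedDiameter.

(* The bound i, j, k < r.+1 is implied by i + j + k = r; it only serves to make
   the vertex set a finType. *)
Definition tri_vertex (r : nat) : finType :=
  {v : 'I_r.+1 * 'I_r.+1 * 'I_r.+1 | v.1.1 + v.1.2 + v.2 == r}.

Definition tri_grid (r : nat) : rel (tri_vertex r) := fun u v =>
  let: (i, j, k) := val u in
  let: (i', j', k') := val v in
  `|i - i'| + `|j - j'| + `|k - k'| == 2.

Lemma tri_grid_sym r : symmetric (@tri_grid r).
Proof.
move=> [[[i j] k] ?] [[[i' j'] k'] ?]; rewrite /tri_grid /=.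
by rewrite (distnC i) (distnC j) (distnC k).
Qed.

Lemma tri_grid_irrefl r : irreflexive (@tri_grid r).
Proof. by move=> [[[i j] k] ?]; rewrite /tri_grid /= !distnn. Qed.

(* Main.v *)
Require Import Defs.
From mathcomp Require Import all_boot all_algebra.
From mathcomp Require Import zify.
Import IntDist.

Set Implicit Arguments.
Unset Strict Implicit.
Unset Printing Implicit Defensive.

(** Lower bound: the side joining the corners (r,0,0) and (0,r,0) is the only
    path of length r between them, so walks of length at most r in both
    directions would use the edge of that side at (r,0,0) in both directions.

    Upper bound: peel T_(r+3) into its boundary ring and the triangle T_r of
    its interior vertices, in which all arcs are reversed.  The ring is directed
    cyclically, and the edges of each triangle formed by a ring edge and an
    interior vertex are directed so that the detour through the interior vertex
    goes the same way as the ring edge.  One arc thus leads from most ring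
    vertices to the interior and one arc back, and the interior has diameter at
    most r+1.  The exceptional vertices lie at or next to a corner, and pass
    from one corner to another along the ring, or along the oppositely directed
    ring just inside it. *)

(** * Dipath lengths and the diameter *)

Section Dipaths.
Variables (V : finType) (o : rel V).

Lemma didist_leq n x y : has_dipath o n x y -> didist o x y <= n.
Proof.
move=> xPy; rewrite leqNgt; apply/negP => n_lt.
have /(before_find 0) := n_lt; rewrite nth_iota ?add0n ?xPy //.
by apply: leq_trans n_lt _; rewrite -[leqRHS](size_iota 0) find_size.
Qed.

Lemma has_dipath_didist x y : connect o x y -> has_dipath o (didist o x y) x y.
Proof.
case/connectP=> p0 /shortenP[p xp Up _] ->.
have size_p : size p < #|V|.
  by rewrite -[_.+1]/(size (x :: p)) -(card_uniqP Up) max_card.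
set z := last x p; have xPz: has (fun n => has_dipath o n x z) (iota 0 #|V|).
  apply/hasP; exists (size p); rewrite ?mem_iota //.
  by apply/existsP; exists (in_tuple p); rewrite xp eqxx.
have := nth_find 0 xPz; rewrite nth_iota ?add0n //.
by move: xPz; rewrite has_find size_iota.
Qed.

Lemma dipath_of_diameter x y : connect o x y ->
  exists p, [/\ path o x p, last x p = y & size p <= diameter o].
Proof.
move/has_dipath_didist/existsP=> [p /andP[xp /eqP lp]]; exists p; split=> //.
rewrite size_tuple.
exact: leq_trans (leq_bigmax y) (leq_bigmax (F := fun x => \max_y didist o x y) x).
Qed.

End Dipaths.

(** With no dimension in the type, triangles of all sizes share one arc relation. *)
Definition triple : Type := nat * nat * nat.

Definition coords r (u : tri_vertex r) : triple :=
  ((val u).1.1 : nat, (val u).1.2 : nat, (val u).2 : nat).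

Definition tsum (u : triple) : nat := u.1.1 + u.1.2 + u.2.

Definition tadj (u v : triple) : bool :=
  `|u.1.1 - v.1.1| + `|u.1.2 - v.1.2| + `|u.2 - v.2| == 2.

Lemma tsum_coords r (u : tri_vertex r) : tsum (coords u) = r.
Proof. by apply/eqP; case: u. Qed.

Lemma coords_inj r : injective (@coords r).
Proof.
move=> [[[i j] k] hu] [[[i' j'] k'] hv] [/= ei ej ek]; apply: val_inj => /=.
by congr (_, _, _); apply: val_inj.
Qed.

Lemma tri_gridE r (u v : tri_vertex r) : tri_grid u v = tadj (coords u) (coords v).
Proof. by case: u v => [[[i j] k] ?] [[[i' j'] k'] ?]. Qed.

Lemma coords_surj r (t : triple) : tsum t = r -> exists u : tri_vertex r, coords u = t.
Proof.
case: t => [[i j] k]; rewrite /tsum /= => ijk.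
have [hi hj hk]: [/\ i < r.+1, j < r.+1 & k < r.+1] by split; lia.
by exists (exist _ (Ordinal hi, Ordinal hj, Ordinal hk) (introT eqP ijk)).
Qed.

(** * Lower bound: forced arcs at a corner *)

Section LowerBound.
Variables (r : nat) (o : rel (tri_vertex r)).
Hypothesis o_grid : forall x y, o x y -> tri_grid x y.

(** The sum being fixed, a total change of 2 alters each coordinate by at most 1 per arc. *)
Lemma path_coords x p i j k i' j' k' : path o x p ->
  coords x = (i, j, k) -> coords (last x p) = (i', j', k') ->
  j <= j' + size p /\ j' <= j + size p.
Proof.
elim: p x i j k => [|y p IHp] x i j k; first by move=> _ /= -> [] _ <- _; lia.
move=> /andP[/o_grid + yp] cx lp; rewrite tri_gridE cx.
case cy: (coords y) => [[a b] c]; have := IHp _ _ _ _ yp cy lp.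
have := tsum_coords y; have := tsum_coords x.
by rewrite cx cy /tadj /tsum /=; lia.
Qed.

End LowerBound.

Lemma tri_diameter_gt r (o : rel (tri_vertex r)) : 0 < r ->
  orientation (@tri_grid r) o -> strongly_connected o -> r < diameter o.
Proof.
move=> r_gt0 [o_grid o_asym] o_conn; rewrite ltnNge; apply/negP => diam_le.
have [A cA] : exists A : tri_vertex r, coords A = (r, 0, 0).
  by apply: coords_surj; rewrite /tsum /=; lia.
have [B cB] : exists B : tri_vertex r, coords B = (0, r, 0).
  by apply: coords_surj; rewrite /tsum /=; lia.
have [A1 cA1] : exists A1 : tri_vertex r, coords A1 = (r.-1, 1, 0).
  by apply: coords_surj; rewrite /tsum /=; lia.
have A1P z i j k : coords z = (i, j, k) -> tri_grid A z -> 0 < j -> z = A1.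
  move=> cz; rewrite tri_gridE cA cz /tadj /= => Az j_gt0.
  have := tsum_coords z; rewrite cz /tsum /= => zr.
  by apply: coords_inj; rewrite cz cA1; congr (_, _, _); lia.
(* At most r-1 arcs follow the first one, so its head already has j > 0. *)
have oA : o A A1.
  have [[|z p] [+ lp sp]] := dipath_of_diameter (o_conn A B).
    by move: cA; rewrite -[A]/(last A [::]) lp cB => -[]; lia.
  move=> /andP[Az zp]; case cz: (coords z) => [[i j] k].
  suff <- : z = A1 by [].
  apply: (A1P _ _ _ _ cz (o_grid _ _ Az)).
  have {}sp : size p < r := leq_trans sp diam_le.
  by have := path_coords o_grid zp cz (etrans (congr1 _ lp) cB); lia.
(* Fewer than r arcs from [B] cannot bring j down to 0, so the last arc starts at [A1]. *)
have Ao : o A1 A.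
  have [p [+ lp sp]] := dipath_of_diameter (o_conn B A).
  case/lastP: p lp sp => [|p z].
    by move=> AB; move: cA; rewrite -AB cB => -[]; lia.
  rewrite last_rcons size_rcons rcons_path => -> sp /andP[Bp zA].
  case cz: (coords (last B p)) => [[i j] k].
  suff <- : last B p = A1 by [].
  apply: (A1P _ _ _ _ cz); first by rewrite tri_grid_sym o_grid.
  by have := path_coords o_grid Bp cB cz; lia.
by have := o_asym _ _ (o_grid _ _ oA); rewrite oA Ao.
Qed.

(* [m] is the layer of the edge and [c] the coordinate constant along it: ring
   edges (c = m) of even layers run from (r,0,0) to (0,r,0) to (0,0,r) and back,
   the other edges of an even layer run the opposite way, and odd layers are
   reversed. *)
Definition arc : rel triple := fun u v =>
  let: (i, j, k) := u in
  let: (i', j', k') := v in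
  let m := minn (minn i i') (minn (minn j j') (minn k k')) in
  let forward c := (c == m) (+) odd m in
  [&& tadj u v, tsum u == tsum v &
      [|| (k == k') && ((j < j') == forward k),
          (i == i') && ((k < k') == forward i) |
          (j == j') && ((i < i') == forward j)]].

(** * Symmetries of the layered orientation *)

Definition rot (u : triple) : triple := (u.2, u.1.1, u.1.2).
Definition shift (u : triple) : triple := (u.1.1.+1, u.1.2.+1, u.2.+1).

Lemma arc_rot u v : arc (rot u) (rot v) = arc u v.
Proof.
case: u v => [[i j] k] [[i' j'] k']; rewrite /arc /rot /=.
have -> : minn (minn k k') (minn (minn i i') (minn j j')) =
  minn (minn i i') (minn (minn j j') (minn k k')) by lia.
rewrite orbC -orbA; congr (_ && (_ && _)); first by rewrite /tadj /=; lia.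
by rewrite /tsum /=; lia.
Qed.

Lemma arc_orient u v : tadj u v -> tsum u = tsum v -> arc u v = ~~ arc v u.
Proof.
case: u v => [[i j] k] [[i' j'] k'] uv suv; rewrite /arc.
have -> : minn (minn i' i) (minn (minn j' j) (minn k' k)) =
  minn (minn i i') (minn (minn j j') (minn k k')) by lia.
have -> : tadj (i', j', k') (i, j, k) by move: uv; rewrite /tadj /=; lia.
rewrite uv suv eqxx /=; move: uv suv; rewrite /tadj /tsum /=.
(* Exactly one coordinate is constant along the edge; the claim then holds for any [m] and any
   parity. *)
set m := minn _ _; move: (odd m) => b; move: m => m.
case: (ltngtP i i') => [lti|lti|<-]; case: (ltngtP j j') => [ltj|ltj|<-];
case: (ltngtP k k') => [ltk|ltk|<-]; try lia; move=> _ _; rewrite /= ?orbF;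
  by case: (_ == m); case: b.
Qed.

(** [shift] embeds T_r as the interior of T_(r+3); the layer grows by 1, so its parity flips. *)
Lemma arc_shift u v : arc (shift u) (shift v) = arc v u.
Proof.
case: u v => [[i j] k] [[i' j'] k']; rewrite /arc /shift /=.
have -> : minn (minn i.+1 i'.+1) (minn (minn j.+1 j'.+1) (minn k.+1 k'.+1)) =
  (minn (minn i' i) (minn (minn j' j) (minn k' k))).+1 by lia.
have -> : tadj (i.+1, j.+1, k.+1) (i'.+1, j'.+1, k'.+1) =
  tadj (i', j', k') (i, j, k) by rewrite /tadj /=; lia.
have -> : tsum (i.+1, j.+1, k.+1) == tsum (i'.+1, j'.+1, k'.+1) =
  (tsum (i', j', k') == tsum (i, j, k)) by rewrite /tsum /=; lia.
set m := minn _ _; rewrite !eqSS !ltnS oddS.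
case: (boolP (tadj _ _)) => //= uv; case: eqP => //=; move: uv.
rewrite /tadj /tsum /=; move: (odd m) => b; move: m => m.
case: (ltngtP i i') => [lti|lti|<-]; case: (ltngtP j j') => [ltj|ltj|<-];
case: (ltngtP k k') => [ltk|ltk|<-]; try lia; move=> _ _; rewrite /= ?orbF;
  by case: (_ == m); case: b.
Qed.

(** * Walks of bounded length *)

Definition walk n (u v : triple) : Prop :=
  exists p, [/\ path arc u p, last u p = v & size p <= n].

Lemma walk_arc u v : arc u v -> walk 1 u v.
Proof. by move=> uv; exists [:: v]; rewrite /= uv. Qed.

Lemma walk_leq m n u v : m <= n -> walk m u v -> walk n u v.
Proof. by move=> mn [p [up lp sp]]; exists p; split=> //; apply: leq_trans mn. Qed.

Lemma walk_cat m n v u w : walk m u v -> walk n v w -> walk (m + n) u w.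
Proof.
move=> [p [up <- sp]] [q [vq <- sq]]; exists (p ++ q).
by rewrite cat_path up vq last_cat size_cat leq_add.
Qed.

Lemma walk_rot n u v : walk n u v -> walk n (rot u) (rot v).
Proof.
move=> [p [up <- sp]]; exists (map rot p); rewrite last_map size_map; split=> //.
by rewrite path_map (eq_path arc_rot).
Qed.

(** The shifted path is traversed backwards, since [shift] reverses arcs. *)
Lemma walk_shift n u v : walk n u v -> walk n (shift v) (shift u).
Proof.
move=> [p [up <- sp]]; exists (rev (belast (shift u) (map shift p))).
rewrite -(last_map shift) rev_path size_rev size_belast size_map; split=> //.
  by rewrite path_map (eq_path (e' := arc)) // => x y; exact: arc_shift.
by case: p {up sp} => //= w p; rewrite rev_cons last_rcons.
Qed.

Lemma walk_side n i j : walk n (i + n, j, 0) (i, j + n, 0).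
Proof.
elim: n j => [|n IHn] j; first by rewrite !addn0; exists [::].
rewrite -(addSnnS j) -add1n; apply: walk_cat (IHn _); apply: walk_arc.
rewrite /arc /tadj /tsum /= min0n !minn0 /=; lia.
Qed.

(** On the boundary, truncated predecessors give spurious entries; [walkb] filters them by [arc]. *)
Definition neighbors (u : triple) : seq triple :=
  let: (i, j, k) := u in
  [:: (i.-1, j.+1, k); (i.+1, j.-1, k); (i, j.-1, k.+1);
      (i, j.+1, k.-1); (i.+1, j, k.-1); (i.-1, j, k.+1)].

Fixpoint walkb n (u v : triple) : bool :=
  (u == v) ||
  if n is m.+1 then has (fun w => arc u w && walkb m w v) (neighbors u)
  else false.

Lemma walkbP n u v : walkb n u v -> walk n u v.
Proof.
elim: n u => [|n IHn] u /= /orP[/eqP <-|//]; try by exists [::].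
move=> /hasP[w _ /andP[/walk_arc uw /IHn wv]]; exact: walk_cat uw wv.
Qed.

Definition triples r : seq triple :=
  [seq (i, j, r - i - j) | i <- iota 0 r.+1, j <- iota 0 (r - i).+1].

Lemma mem_triples r u : tsum u = r -> u \in triples r.
Proof.
case: u => [[i j] k]; rewrite /tsum /= => ijk.
by apply/allpairsPdep; exists i, j; rewrite !mem_iota; split; try congr (_, _, _); lia.
Qed.

(** Base cases of the induction with stride 3, by exhaustive search. *)
Lemma walk_small r u v : r < 3 -> tsum u = r -> tsum v = r -> walk r.+1 u v.
Proof.
move=> r_lt3 /mem_triples ru /mem_triples rv; apply: walkbP.
suff /allP/(_ u ru)/allP/(_ v rv) :
  all (fun u => all (walkb r.+1 u) (triples r)) (triples r) by [].
by case: r r_lt3 {ru rv} => [|[|[|]]].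
Qed.

(** * Induction step from dimension r to r+3 *)

Ltac boundary_arc :=
  apply: walk_arc; rewrite /arc /tadj /tsum /= ?min0n ?minn0 ?min0n /=; lia.

(* [P] and its rotations are the bottleneck for entering the interior of the
   triangle of dimension r+3, [Q] and its rotations the one for leaving it. *)
Section Step.
Variable r : nat.

Let P : triple := (r.+2, 1, 0).
Let Q : triple := (r.+2, 0, 1).

(** On the side k = 0, all vertices with i >= 2 and j >= 1 have an arc inwards; the other three have
    an arc to [P] or [rot P]. Rotation gives the other sides. *)
Lemma walk_enter u : tsum u = r.+3 ->
  (exists2 w, tsum w = r & walk 1 u (shift w)) \/
  (exists2 a, a < 3 & walk 1 u (iter a rot P)).
Proof.
pose enters u := (exists2 w, tsum w = r & walk 1 u (shift w)) \/
  (exists2 a, a < 3 & walk 1 u (iter a rot P)).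
have enters_side i j : i + j = r.+3 -> enters (i, j, 0).
  case: j => [|j] ij; first by right; exists 0 => //; boundary_arc.
  case: i ij => [|[|i]] ij; try by right; exists 1 => //; boundary_arc.
  by left; exists (i, j, 0); [rewrite /tsum /=; lia | boundary_arc].
have enters_rot v : enters v -> enters (rot v).
  move=> [[w wr /walk_rot vw]|[a a_lt3 /walk_rot va]].
    by left; exists (rot w) => //; rewrite -wr /tsum /=; lia.
  right; case: a a_lt3 va => [|[|[|]]] // _ va; by [exists 1 | exists 2 | exists 0].
case: u => [[i j] [|k]]; rewrite /tsum /= => ijk.
  by apply: enters_side; rewrite -ijk addn0.
case: j ijk => [|j] ijk.
  by apply: (enters_rot (rot (k.+1, i, 0))); apply/enters_rot/enters_side; lia.
case: i ijk => [|i] ijk.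
  by apply: (enters_rot (j.+1, k.+1, 0)); apply: enters_side; lia.
by left; exists (i, j, k); [rewrite /tsum /=; lia | exists [::]].
Qed.

(** Exchanging i and j reverses all arcs, which turns the argument for [walk_enter] into this
    one. *)
Lemma walk_exit v : tsum v = r.+3 ->
  (exists2 w, tsum w = r & walk 1 (shift w) v) \/
  (exists2 b, b < 3 & walk 1 (iter b rot Q) v).
Proof.
pose exits v := (exists2 w, tsum w = r & walk 1 (shift w) v) \/
  (exists2 b, b < 3 & walk 1 (iter b rot Q) v).
have exits_side i j : i + j = r.+3 -> exits (i, j, 0).
  case: i => [|i] ij; first by right; exists 1 => //; boundary_arc.
  case: j ij => [|[|j]] ij; try by right; exists 0 => //; boundary_arc.
  by left; exists (i, j, 0); [rewrite /tsum /=; lia | boundary_arc].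
have exits_rot u : exits u -> exits (rot u).
  move=> [[w wr /walk_rot wu]|[b b_lt3 /walk_rot bu]].
    by left; exists (rot w) => //; rewrite -wr /tsum /=; lia.
  right; case: b b_lt3 bu => [|[|[|]]] // _ bu; by [exists 1 | exists 2 | exists 0].
case: v => [[i j] [|k]]; rewrite /tsum /= => ijk.
  by apply: exits_side; rewrite -ijk addn0.
case: j ijk => [|j] ijk.
  by apply: (exits_rot (rot (k.+1, i, 0))); apply/exits_rot/exits_side; lia.
case: i ijk => [|i] ijk.
  by apply: (exits_rot (j.+1, k.+1, 0)); apply: exits_side; lia.
by left; exists (i, j, k); [rewrite /tsum /=; lia | exists [::]].
Qed.

(** Between two exceptional vertices, the generic route through the interior could take 2 + (r+1) +
    2 arcs, one too many. *)
Lemma walk_ring a b : a < 3 -> b < 3 ->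
  walk r.+2 (iter a rot P) (iter b rot Q).
Proof.
have PZ : walk 1 P (shift (r, 0, 0)) by boundary_arc.
have walk0 : walk r.+2 P Q.
  have ZQ : walk 1 (shift (r, 0, 0)) Q by boundary_arc.
  exact: walk_leq (walk_cat PZ ZQ).
have walk1 : walk r.+2 P (rot Q).
  have := walk_side r.+1 1 1; rewrite !add1n; exact: walk_leq.
(* The outer ring would go the long way round; the ring just inside runs the opposite way and gives
   1 + r + 1 arcs. *)
have walk2 : walk r.+2 P (rot (rot Q)).
  have := walk_shift (walk_rot (walk_rot (walk_side r 0 0))) => ZX.
  have XQ : walk 1 (shift (0, 0, r)) (0, 1, r.+2) by boundary_arc.
  by have := walk_cat PZ (walk_cat ZX XQ); rewrite add1n addn1.
(* Up to rotation only b - a modulo 3 matters. *)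
case: a => [|[|[|]]] // _; case: b => [|[|[|]]] // _ //=;
  by [apply: walk_rot | apply: (walk_rot walk2) | do 2!apply: walk_rot
     |apply: (walk_rot (walk_rot walk1)) | apply: (walk_rot (walk_rot walk2))].
Qed.

Lemma walk_step :
  (forall u v, tsum u = r -> tsum v = r -> walk r.+1 u v) ->
  forall u v, tsum u = r.+3 -> tsum v = r.+3 -> walk r.+4 u v.
Proof.
move=> IHr.
have inner u v : tsum u = r -> tsum v = r -> walk r.+1 (shift u) (shift v).
  by move=> ur vr; apply/walk_shift/IHr.
have tsum_rot a : tsum (iter a rot (r, 0, 0)) = r.
  elim: a => [|a] /=; first by rewrite /tsum /= !addn0.
  by move=> {2}<-; rewrite /tsum /rot /=; lia.
have P_in a : walk 1 (iter a rot P) (shift (iter a rot (r, 0, 0))).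
  by elim: a => [|a] /=; [boundary_arc | apply: walk_rot].
have Q_out b : walk 1 (shift (iter b rot (r, 0, 0))) (iter b rot Q).
  by elim: b => [|b] /=; [boundary_arc | apply: walk_rot].
move=> u v /walk_enter u_in /walk_exit v_out.
(* The lengths are at most 1 + (r+1) + 1, 1 + (r+1) + 2, 2 + (r+1) + 1 and 1 + (r+2) + 1. *)
case: u_in v_out => [[w wr uw]|[a a_lt3 ua]] [[z zr zv]|[b b_lt3 bv]].
- by apply: walk_leq (walk_cat uw (walk_cat (inner _ _ wr zr) zv)); lia.
- apply: walk_leq (walk_cat uw (walk_cat (inner _ _ wr (tsum_rot b))
    (walk_cat (Q_out b) bv))); lia.
- apply: walk_leq (walk_cat ua (walk_cat (P_in a)
    (walk_cat (inner _ _ (tsum_rot a) zr) zv))); lia.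
- apply: walk_leq (walk_cat ua (walk_cat (walk_ring a_lt3 b_lt3) bv)); lia.
Qed.

End Step.

Lemma walk_tri r u v : tsum u = r -> tsum v = r -> walk r.+1 u v.
Proof.
elim/ltn_ind: r u v => -[|[|[|r]]] IHr u v; try exact: walk_small.
by apply: walk_step => {}u {}v; apply: IHr; lia.
Qed.

(** * Transfer to the finite graph *)

Definition tri_orientation r : rel (tri_vertex r) :=
  fun u v => arc (coords u) (coords v).

Lemma tri_orientationP r : orientation (@tri_grid r) (@tri_orientation r).
Proof.
split=> u v; rewrite tri_gridE /tri_orientation.
  by case: (coords u) (coords v) => [[i j] k] [[i' j'] k'] /and3P[].
by move=> uv; apply: arc_orient; rewrite ?tsum_coords.
Qed.

(** Arcs preserve [tsum], so every vertex of the walk lifts to [tri_vertex r]. *)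
Lemma walk_dipath r n (u v : tri_vertex r) : walk n (coords u) (coords v) ->
  exists p, [/\ path (@tri_orientation r) u p, last u p = v & size p <= n].
Proof.
move=> [q [uq lq sq]].
suff [p up qE] : exists2 p, path (@tri_orientation r) u p & q = map (@coords r) p.
  exists p; split=> //; last by rewrite qE size_map in sq.
  by apply: coords_inj; rewrite -lq qE last_map.
elim: q u uq {lq sq} => [|t q IHq] u /=; first by exists [::].
case/andP=> ut tq; have [w wt] : exists w : tri_vertex r, coords w = t.
  apply: coords_surj; rewrite -(tsum_coords u).
  by case: (coords u) t ut {tq} => [[i j] k] [[i' j'] k'] /and3P[_ /eqP ->].
rewrite -wt in ut tq *; have [p wp ->] := IHq _ tq.
by exists (w :: p) => //=; rewrite [tri_orientation _ _]ut.
Qed.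

Theorem theorem1 (r : nat) (hr : 2 < r) :
  is_oriented_diameter (@tri_grid r) r.+1.
Proof.
have r_gt0 : 0 < r by apply: leq_trans hr.
split=> [|o]; last exact: tri_diameter_gt.
have dipath (u v : tri_vertex r) :=
  walk_dipath (walk_tri (tsum_coords u) (tsum_coords v)).
have conn : strongly_connected (@tri_orientation r).
  by move=> u v; have [p [up <- _]] := dipath u v; apply/connectP; exists p.
exists (@tri_orientation r); split=> //; first exact: tri_orientationP.
apply/eqP; rewrite eqn_leq tri_diameter_gt ?andbT //; last exact: tri_orientationP.
apply/bigmax_leqP => u _; apply/bigmax_leqP => v _.
have [p [up lp sp]] := dipath u v; apply: leq_trans sp; apply: didist_leq.
by apply/existsP; exists (in_tuple p); rewrite up lp eqxx.
Qed.
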